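(* Let $n\ge 1$, let $\mathbf{\Sigma}=\{\Sigma_t=(\mathbf{x}_t,B_t)\}_{t\in\mathbb{T}_n}$ be a cluster pattern of rank $n$ with root vertex $t_0\in\mathbb{T}_n$, and let $\mathcal{A}$ be the cluster algebra corresponding to $\mathbf{\Sigma}$. Let $$\mathcal{B}(t_0)=\{[B_s]\mid s \text{ lies in the path } p(t_0,t) \text{ for some } p(t_0,t)\in\mathcal{P}_1(t_0)\}.$$ If $\mathcal{B}(t_0)$ is a finite set, then the cluster automorphism group $\operatorname{Aut}(\mathcal{A})$ is finitely generated.
   Context: Write $[b]_+=\max(b,0)$. Let $\mathcal{F}$ be the field of rational functions in $n$ variables over $\mathbb{Q}$. An integer $n\times n$ matrix $B$ is skew-symmetrizable if there is a diagonal matrix $D$ with positive integer diagonal entries such that $(DB)^T=-DB$. A labeled seed of rank $n$ in $\mathcal{F}$ is a pair $\Sigma=(\mathbf{x},B)$ where $\mathbf{x}=(x_1,\dots,x_n)$ (the cluster) is a transcendence basis of $\mathcal{F}$ over $\mathbb{Q}$ (as usual, generating $\mathcal F$ as a field) and $B=(b_{ij})$ (the exchange matrix) is an $n\times n$ skew-symmetrizable integer matrix. For $k\in\{1,\dots,n\}$ the mutation $\mu_k(\Sigma)=(\mathbf{x}',B')$ is the labeled seed with $x'_i=x_i$ for $i\ne k$, $x'_k=x_k^{-1}\left(\prod_{j}x_j^{[b_{jk}]_+}+\prod_j x_j^{[-b_{jk}]_+}\right)$, and $b'_{ij}=-b_{ij}$ if $i=k$ or $j=k$, $b'_{ij}=b_{ij}+b_{ik}[b_{kj}]_++[-b_{ik}]_+b_{kj}$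 otherwise. We write $\mu_k(\mathbf{x})$ for the cluster of $\mu_k(\Sigma)$. $\mathbb{T}_n$ is the $n$-regular tree with edges labeled by $1,\dots,n$ so that the $n$ edges at each vertex have distinct labels. A cluster pattern of rank $n$ is a family $\mathbf{\Sigma}=\{\Sigma_t=(\mathbf{x}_t,B_t)\}_{t\in\mathbb{T}_n}$ of labeled seeds, indexed by the vertices, such that $\Sigma_{t'}=\mu_k(\Sigma_t)$ whenever $t,t'$ are joined by an edge labeled $k$; a fixed vertex $t_0$ is called the root vertex. Write $\mathbf{x}_t=(x_{1;t},\dots,x_{n;t})$. The associated cluster algebra $\mathcal{A}$ is the $\mathbb{Z}$-subalgebra of $\mathcal{F}$ generated by all cluster variables $x_{i;t}$. For $\sigma\in S_n$: $\sigma\mathbf{x}=(x_{\sigma^{-1}(1)},\dots,x_{\sigma^{-1}(n)})$ and $\sigma(B)=(b_{\sigma^{-1}(i)\sigma^{-1}(j)})_{i,j}$. A $\mathbb{Z}$-algebra automorphism $f$ of $\mathcal{A}$ is a cluster automorphism if there exist seeds $\Sigma=(\mathbf{x},B),\Sigma'=(\mathbf{x}',B')$ in $\mathbf{\Sigma}$ and $\sigma\in S_n$ with $\sigma(f(\mathbf{x}))=\mathbf{x}'$ and $\sigma(f(\mu_k(\mathbf{x})))=\mu_{\sigma(k)}(\mathbf{x}')$ for all $k\in\{1,\dots,n\}$ ($f$ applied entrywise). The cluster automorphisms form a group $\operatorname{Aut}(\mathcal{A})$ under composition. $[B]$ denotes the equivalence class of $B$ consisting of the matrices $\pm\sigma(B)$,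 $\sigma\in S_n$. For $s,t\in\mathbb{T}_n$, $p(s,t)$ is the unique (non-backtracking) path from $s$ to $t$ in $\mathbb{T}_n$; the vertices lying in it include both endpoints. For a vertex $t'$, the weight is $\mathbf{w}_{t'}(s,t)=\#\{t''\in\mathbb{T}_n\mid t''\text{ lies in }p(s,t)\text{ and }[B_{t''}]=[B_{t'}]\}$. For $m\ge 0$, $\mathcal{P}_m(t_0)=\{p(t_0,t)\mid \mathbf{w}_{t_0}(t_0,t)=m+1\text{ and }[B_t]=[B_{t_0}]\}$; so $\mathcal{P}_1(t_0)$ consists of the paths from $t_0$ to some $t\neq t_0$ with $[B_t]=[B_{t_0}]$ none of whose interior vertices $t''$ satisfies $[B_{t''}]=[B_{t_0}]$. *)

(* Defs.v *)
(* MathComp, with the sets and choice principles of mathcomp-classical. *)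
From HB Require Import structures.
From mathcomp Require Import all_boot all_order all_fingroup all_algebra.
From mathcomp Require Import boolp classical_sets cardinality.
From mathcomp Require Import fraction mpoly.

Set Implicit Arguments.
Unset Strict Implicit.
Unset Printing Implicit Defensive.

Import Order.TTheory GRing.Theory Num.Theory.
Local Open Scope classical_set_scope.
Local Open Scope ring_scope.

Definition ratfield (n : nat) : fieldType := {fraction {mpoly rat[n]}}.

Definition posp (b : int) : int := Num.max b 0.

(* [mmap ratr x p] is the value of p at x. *)
Definition alg_independent n (x : {ffun 'I_n -> ratfield n}) : Prop :=
  forall p : {mpoly rat[n]}, mmap ratr x p = 0 -> p = 0.

Definition generates_field n (x : {ffun 'I_n -> ratfield n}) : Prop :=
  forall z : ratfield n, exists p q : {mpoly rat[n]},
    mmap ratr x q != 0 /\ z = mmap ratr x p / mmap ratr x q.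

Definition skew_symmetrizable n (B : 'M[int]_n) : Prop :=
  exists2 d : 'rV[int]_n, (forall i, 0 < d ord0 i) &
    (diag_mx d *m B)^T = - (diag_mx d *m B).

Record preseed (n : nat) := Preseed {
  cluster : {ffun 'I_n -> ratfield n};
  exchange : 'M[int]_n }.

(* A cluster that generates the field is in particular a transcendence basis
   as soon as it is algebraically independent. *)
Definition labeled_seed n (s : preseed n) : Prop :=
  [/\ alg_independent (cluster s), generates_field (cluster s)
    & skew_symmetrizable (exchange s)].

Definition mutate_cluster n (k : 'I_n) (s : preseed n) :
    {ffun 'I_n -> ratfield n} :=
  let x := cluster s in let B := exchange s in
  [ffun i => if i == k
    then (x k)^-1 * (\prod_j x j ^ posp (B j k) + \prod_j x j ^ posp (- B j k))
    else x i].

Definition mutate_matrix n (k : 'I_n) (B : 'M[int]_n) : 'M[int]_n :=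
  \matrix_(i, j) (if (i == k) || (j == k) then - B i j
    else B i j + B i k * posp (B k j) + posp (- B i k) * B k j).

Definition mutate n (k : 'I_n) (s : preseed n) : preseed n :=
  Preseed (mutate_cluster k s) (mutate_matrix k (exchange s)).

(* The n-regular edge-labeled tree: its vertices are the words in the labels
   without equal adjacent letters, and an edge labeled k adds or removes a
   letter k at the head. *)
Definition tree (n : nat) := {w : seq 'I_n | sorted [rel i j | i != j] w}.

Definition tree_edge n (k : 'I_n) (t t' : tree n) : bool :=
  (val t' == k :: val t) || (val t == k :: val t').

Definition tree_adj n : rel (tree n) :=
  [rel t t' | [exists k, tree_edge k t t']].

(* p lists the vertices of p(s, t) after s, in order, so that the vertices
   lying in the path are those of s :: p. *)
Definition tree_path n (s t : tree n) (p : seq (tree n)) : bool :=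
  [&& path (@tree_adj n) s p, last s p == t & uniq (s :: p)].

Record cluster_pattern (n : nat) := ClusterPattern {
  seed_at :> tree n -> preseed n;
  seed_atP : forall t, labeled_seed (seed_at t);
  seed_at_mutate : forall k t t', tree_edge k t t' ->
    seed_at t' = mutate k (seed_at t) }.

Definition perm_cluster n (s : 'S_n) (x : {ffun 'I_n -> ratfield n}) :
  {ffun 'I_n -> ratfield n} := [ffun i => x ((s^-1)%g i)].

Definition perm_matrix n (s : 'S_n) (B : 'M[int]_n) : 'M[int]_n :=
  \matrix_(i, j) B ((s^-1)%g i) ((s^-1)%g j).

Definition matrix_class n (B : 'M[int]_n) : set 'M[int]_n :=
  [set M | exists s : 'S_n, M = perm_matrix s B \/ M = - perm_matrix s B].

Section ClusterAlgebra.
Variables (n : nat) (S : cluster_pattern n).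

Definition cluster_variables : set (ratfield n) :=
  [set x | exists t i, x = cluster (S t) i].

Definition cluster_algebra_set : set (ratfield n) :=
  smallest [set U : set (ratfield n) | GRing.subring_closed (mem U)]
    cluster_variables.

Definition cluster_algebra_pred : {pred ratfield n} :=
  fun x => x \in cluster_algebra_set.

Lemma cluster_algebra_subring : GRing.subring_closed cluster_algebra_pred.
Proof.
split.
- by apply/mem_set => U [[/set_mem ? _ _] _].
- move=> x y /set_mem Ax /set_mem Ay; apply/mem_set => U HU.
  have [[_ subU _] _] := HU.
  by apply/set_mem/subU; apply/mem_set; [exact: Ax | exact: Ay].
- move=> x y /set_mem Ax /set_mem Ay; apply/mem_set => U HU.
  have [[_ _ mulU] _] := HU.
  by apply/set_mem/mulU; apply/mem_set; [exact: Ax | exact: Ay].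
Qed.

HB.instance Definition _ :=
  GRing.isSubringClosed.Build (ratfield n) cluster_algebra_pred
    cluster_algebra_subring.

Record cluster_algebra := ClusterAlgebra {
  cluster_algebra_val :> ratfield n;
  cluster_algebra_valP : cluster_algebra_val \in cluster_algebra_pred }.

HB.instance Definition _ := [isSub for cluster_algebra_val].
HB.instance Definition _ := [Choice of cluster_algebra by <:].
HB.instance Definition _ :=
  [SubChoice_isSubComNzRing of cluster_algebra by <:].

(* Entrywise application of f to a tuple x of elements of the cluster algebra;
   an entry of x outside the cluster algebra would be read as 0, which
   [cluster_mem] and [mutate_cluster_mem] exclude where this is used. *)
Definition apply_cluster (f : cluster_algebra -> cluster_algebra)
    (x : {ffun 'I_n -> ratfield n}) : {ffun 'I_n -> ratfield n} :=
  [ffun i => val (f (insubd (0 : cluster_algebra) (x i)))].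

Lemma cluster_mem t i : cluster (S t) i \in cluster_algebra_pred.
Proof. by apply/mem_set => U [_]; apply; exists t, i. Qed.

Lemma tree_neighbor k (t : tree n) : exists t', tree_edge k t t'.
Proof.
case: t => -[|i w] wP.
  by exists (Sub [:: k] isT : tree n); rewrite /tree_edge /= eqxx.
have [eq_ik|neq_ki] := eqVneq i k.
  exists (Sub w (path_sorted wP) : tree n).
  by rewrite /tree_edge /= eq_ik eqxx orbT.
have kP : sorted [rel i j | i != j] [:: k, i & w].
  by rewrite /= eq_sym neq_ki.
by exists (Sub [:: k, i & w] kP : tree n); rewrite /tree_edge /= eqxx.
Qed.

Lemma mutate_cluster_mem k t i :
  mutate_cluster k (S t) i \in cluster_algebra_pred.
Proof.
have [t' /(seed_at_mutate S) eqS] := tree_neighbor k t.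
by have := cluster_mem t' i; rewrite eqS.
Qed.

Definition cluster_automorphisms : set (cluster_algebra -> cluster_algebra) :=
  [set f | [/\ zmod_morphism f, GRing.monoid_morphism f, bijective f &
    exists (t t' : tree n) (s : 'S_n),
      perm_cluster s (apply_cluster f (cluster (S t))) = cluster (S t') /\
      forall k : 'I_n,
        perm_cluster s (apply_cluster f (mutate_cluster k (S t)))
          = mutate_cluster (s k) (S t')]].

Definition weight (t' s : tree n) (p : seq (tree n)) : nat :=
  count (fun r => `[< matrix_class (exchange (S r))
                      = matrix_class (exchange (S t')) >]) (s :: p).

Definition return_paths (m : nat) (t0 : tree n) : set (seq (tree n)) :=
  [set p | exists t, [/\ tree_path t0 t p, weight t0 t0 p = m.+1 &
    matrix_class (exchange (S t)) = matrix_class (exchange (S t0))]].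

Definition return_classes (t0 : tree n) : set (set 'M[int]_n) :=
  [set c | exists2 p, return_paths 1 t0 p &
    exists2 s, s \in t0 :: p & c = matrix_class (exchange (S s))].

End ClusterAlgebra.

Definition composition_subgroup T (H : set (T -> T)) : Prop :=
  [/\ H id, forall f g, H f -> H g -> H (f \o g)
    & forall f g, H f -> cancel f g -> cancel g f -> H g].

(* G is a group under composition generated by a finite subset; that G is
   closed under composition and inverses is part of the property. *)
Definition finitely_generated_group T (G : set (T -> T)) : Prop :=
  exists2 X : set (T -> T), finite_set X &
    G = smallest (@composition_subgroup T) X.

(* Main.v *)
From HB Require Import structures.
Require Import Defs.
From mathcomp Require Import all_boot all_order all_fingroup all_algebra.
From mathcomp Require Import boolp classical_sets cardinality.
From mathcomp Require Import fraction mpoly zify ring.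

Set Implicit Arguments.
Unset Strict Implicit.
Unset Printing Implicit Defensive.

Import Order.TTheory GRing.Theory Num.Theory.
Local Open Scope classical_set_scope.
Local Open Scope ring_scope.

(* An automorphism carrying the seed at t to the seed at t' carries the k-th
   neighbor of t to the s(k)-th neighbor of t', so Aut(A) is the image of a
   group acting on the tree with finite vertex stabilizers.  Automorphisms
   preserving exchange matrices up to one global sign move t0 within the set of
   vertices t with [B_t] = [B_t0].  A path between two such vertices is a
   concatenation of translates of paths in P_1(t0), so it meets finitely many
   classes; comparing consecutive vertices of the path with fixed class
   representatives writes the automorphism as a product of the finitely many
   ones that send a representative to, or next to, another representative.
   When B is decomposable, an automorphism may change the sign of each block of
   B independently; the sign-preserving ones then still have finite index, and
   finitely many coset representatives complete the generating set. *)

(** * Exchange matrices *)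

Lemma posp_ge0 b : 0 <= posp b.
Proof. by rewrite /posp le_max lexx orbT. Qed.

Lemma posp0 : posp 0 = 0.
Proof. by rewrite /posp maxxx. Qed.

Lemma pospB b : posp b - posp (- b) = b.
Proof.
by rewrite /posp !maxEle oppr_le0; case: (lerP b 0) => b0; case: (lerP 0 b) => b1; lia.
Qed.

(** Such an [e] amounts to one sign for each indecomposable block of [B]. *)
Definition sign_constant_on n (e : {ffun 'I_n -> bool}) (B : 'M[int]_n) :=
  forall i j, B i j != 0 -> e i = e j.

(* The relation that a cluster automorphism induces on exchange matrices: the
   sign may depend on the indecomposable block, whereas in [matrix_class] it
   is global. *)
Definition signed_perm n (s : 'S_n) (e : {ffun 'I_n -> bool})
    (B B' : 'M[int]_n) : Prop :=
  (forall i j, B' (s i) (s j) = (-1) ^+ e j * B i j) /\ sign_constant_on e B.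

Definition const_sign n (b : bool) : {ffun 'I_n -> bool} := [ffun=> b].

Section SignedPerm.
Variable n : nat.
Implicit Types (s : 'S_n) (e : {ffun 'I_n -> bool}) (B : 'M[int]_n).

Lemma signed_perm_id B : signed_perm 1%g (const_sign n false) B B.
Proof. by split=> i j; rewrite !ffunE // !perm1 mul1r. Qed.

Lemma signed_perm_comp s1 e1 s2 e2 B1 B2 B3 :
  signed_perm s1 e1 B1 B2 -> signed_perm s2 e2 B2 B3 ->
  signed_perm (s1 * s2)%g [ffun i => e1 i (+) e2 (s1 i)] B1 B3.
Proof.
move=> [B12 e1P] [B23 e2P]; split=> i j.
  by rewrite !permM B23 B12 ffunE mulrA -signr_addb addbC.
move=> Bij; rewrite !ffunE (e1P i j) // (e2P (s1 i) (s1 j)) // B12.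
by rewrite mulf_neq0 ?signr_eq0.
Qed.

Lemma signed_perm_inv s e B1 B2 :
  signed_perm s e B1 B2 ->
  signed_perm (s^-1)%g [ffun i => e ((s^-1)%g i)] B2 B1.
Proof.
move=> [B12 eP].
have B21 i j : B1 ((s^-1)%g i) ((s^-1)%g j)
    = (-1) ^+ e ((s^-1)%g j) * B2 i j.
  have := B12 ((s^-1)%g i) ((s^-1)%g j); rewrite !permKV => ->.
  by rewrite mulrA -signr_addb addbb mul1r.
split=> i j; rewrite !ffunE // => Bij; apply: eP.
by rewrite B21 mulf_neq0 ?signr_eq0.
Qed.

(** The correction to $b_{ij}$ vanishes unless $b_{ik}$ and $b_{kj}$ are both nonzero, and then
    $i,j,k$ carry one sign. A common sign passes through the correction because $[-c]_+=[c]_+-c$. *)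
Lemma signed_perm_mutate k s e B B' :
  signed_perm s e B B' ->
  signed_perm s e (mutate_matrix k B) (mutate_matrix (s k) B').
Proof.
move=> [BB' eP]; split=> i j; rewrite !mxE; last first.
  case: ifP => [_|_ nz]; first by rewrite oppr_eq0; apply: eP.
  have [Bij|/eP//] := eqVneq (B i j) 0.
  have [Bik|/eP->] := eqVneq (B i k) 0.
    by move: nz; rewrite Bij Bik oppr0 posp0 !mul0r !addr0 eqxx.
  have [Bkj|/eP//] := eqVneq (B k j) 0.
  by move: nz; rewrite Bij Bkj posp0 !mulr0 !addr0 eqxx.
rewrite !(inj_eq perm_inj) !BB'.
case: ifP => _; first by rewrite mulrN.
have [->|Bik] := eqVneq (B i k) 0.
  by rewrite !(mulr0, oppr0, posp0, mul0r, addr0).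
have [->|Bkj] := eqVneq (B k j) 0; first by rewrite !(mulr0, posp0, addr0).
rewrite -(eP _ _ Bkj); case: (e k); last by rewrite !mul1r.
have nposp c : posp (- c) = posp c - c by rewrite -{3}(pospB c); ring.
by rewrite !mulN1r opprK !nposp; ring.
Qed.

Lemma perm_matrixE s B i j : perm_matrix s B (s i) (s j) = B i j.
Proof. by rewrite !mxE !permK. Qed.

Lemma signed_perm_const s b B B' :
  signed_perm s (const_sign n b) B B' <-> B' = (-1) ^+ b *: perm_matrix s B.
Proof.
split=> [[BB' _]|->].
  apply/matrixP => i j; rewrite -[i](permKV s) -[j](permKV s) BB' ffunE mxE.
  by rewrite perm_matrixE.
by split=> i j; rewrite !ffunE // mxE perm_matrixE.
Qed.

Lemma mem_matrix_class B M :
  matrix_class B M <-> exists s b, signed_perm s (const_sign n b) B M.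
Proof.
split=> [[s [->|->]]|[s [b /signed_perm_const ->]]].
- by exists s, false; apply/signed_perm_const; rewrite expr0 scale1r.
- by exists s, true; apply/signed_perm_const; rewrite expr1 scaleN1r.
- exists s; case: b; [right|left]; first by rewrite expr1 scaleN1r.
  by rewrite expr0 scale1r.
Qed.

Lemma matrix_class_eq B B' :
  matrix_class B = matrix_class B' <->
  exists s b, signed_perm s (const_sign n b) B B'.
Proof.
have invP s b M M' : signed_perm s (const_sign n b) M M' ->
    signed_perm (s^-1)%g (const_sign n b) M' M.
  move=> /signed_perm_inv; congr signed_perm.
  by apply/ffunP=> i; rewrite !ffunE.
have compP s1 b1 s2 b2 M M' M'' : signed_perm s1 (const_sign n b1) M M' ->
    signed_perm s2 (const_sign n b2) M' M'' ->
    signed_perm (s1 * s2)%g (const_sign n (b1 (+) b2)) M M''.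
  move=> /signed_perm_comp /[apply]; congr signed_perm.
  by apply/ffunP=> i; rewrite !ffunE.
split=> [eqC|[s [b BB']]].
  apply/mem_matrix_class; rewrite eqC; apply/mem_matrix_class.
  by exists 1%g, false; apply: signed_perm_id.
apply/seteqP; split=> M /mem_matrix_class [s' [b' BM]]; apply/mem_matrix_class.
  by exists (s^-1 * s')%g, (b (+) b'); apply: compP BM; apply: invP.
by exists (s * s')%g, (b (+) b'); apply: compP BM.
Qed.

End SignedPerm.

(** * Free generators of the field *)

Section Evaluation.
Variable n : nat.
Implicit Types (x y : {ffun 'I_n -> ratfield n}) (p q : {mpoly rat[n]}).

Lemma ratr_ratfield : @ratr (ratfield n) = @FracField.tofrac _ \o @mpolyC n rat.
Proof.
pose g : {rmorphism rat -> ratfield n} := @FracField.tofrac _ \o @mpolyC n rat.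
apply/funext => r; rewrite -[RHS]/(g r) -[in RHS](divq_num_den r) fmorph_div.
by rewrite !rmorph_int.
Qed.

(* Making [ratr] a ring morphism requires an ordered target field; here it is
   the embedding of the constants. *)
Definition eval_at x : {rmorphism {mpoly rat[n]} -> ratfield n} :=
  mmap (@FracField.tofrac _ \o @mpolyC n rat) x.

Lemma eval_atE x p : mmap ratr x p = eval_at x p.
Proof. by rewrite ratr_ratfield. Qed.

Lemma eval_atX x m : eval_at x 'X_[m] = \prod_j x j ^+ m j.
Proof. exact: mmapX. Qed.

Lemma eval_at_perm (s : 'S_n) x p :
  eval_at [ffun i => x (s i)] p = eval_at x (msym s p).
Proof.
rewrite /msym /mmap raddf_sum /=; apply: eq_bigr => m _.
rewrite rmorphM rmorph_prod /= mmapC; congr (_ * _).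
by apply: eq_bigr => i _; rewrite ffunE rmorphXn /= mmapX mmap1U.
Qed.

Lemma alg_independent_eq0 x p :
  alg_independent x -> (eval_at x p == 0) = (p == 0).
Proof.
move=> xP; apply/eqP/eqP => [|->]; last exact: rmorph0.
by rewrite -eval_atE => /xP.
Qed.

Lemma alg_independent_inj x : alg_independent x -> injective (eval_at x).
Proof.
move=> xP p q /eqP; rewrite -subr_eq0 -rmorphB alg_independent_eq0 //.
by rewrite subr_eq0 => /eqP.
Qed.

Lemma alg_independent_perm (s : 'S_n) x :
  alg_independent x -> alg_independent [ffun i => x (s i)].
Proof.
move=> xP p; rewrite eval_atE eval_at_perm => /eqP.
rewrite alg_independent_eq0 // => /eqP ps0.
by apply: (@inj_msym _ _ s); rewrite ps0 raddf0.
Qed.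

Lemma alg_independent_neq0 x i : alg_independent x -> x i != 0.
Proof.
move=> xP; have -> : x i = eval_at x 'X_i by rewrite /= mmapX mmap1U.
rewrite alg_independent_eq0 //; apply: contra_neq (oner_neq0 rat) => Xi0.
by have := mcoeffX rat U_(i) U_(i); rewrite Xi0 mcoeff0 eqxx.
Qed.

(** The value $p(x)/q(x)$ is sent to $p(y)/q(y)$. Independence of [x] turns an equality of fractions
    into a polynomial identity, which then holds at [y]; independence of [y] keeps the denominators
    nonzero. *)
Lemma field_morphism_of_clusters x y :
  alg_independent x -> generates_field x -> alg_independent y ->
  exists phi : {rmorphism ratfield n -> ratfield n}, forall i, phi (x i) = y i.
Proof.
move=> xP gx yP.
have {}gx z : exists pq : {mpoly rat[n]} * {mpoly rat[n]},
    pq.2 != 0 /\ z = eval_at x pq.1 / eval_at x pq.2.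
  have [p [q [q0 ->]]] := gx z; exists (p, q); rewrite !eval_atE /= in q0 *.
  by split => //; rewrite -(alg_independent_eq0 _ xP).
pose f z := let pq := projT1 (cid (gx z)) in eval_at y pq.1 / eval_at y pq.2.
have fE p q : q != 0 ->
    f (eval_at x p / eval_at x q) = eval_at y p / eval_at y q.
  move=> q0; rewrite /f; case: cid => -[p' q'] /= [q'0 /eqP].
  rewrite eqr_div ?alg_independent_eq0 // -!rmorphM => /eqP.
  move=> /(alg_independent_inj xP) eqpq; apply/eqP.
  by rewrite eqr_div ?alg_independent_eq0 // -!rmorphM eqpq.
have fE1 p : f (eval_at x p) = eval_at y p.
  by have := fE p 1 (oner_neq0 _); rewrite !rmorph1 !divr1.
have fB : zmod_morphism f.
  move=> u v; have [[p q] /= [q0 ->]] := gx u; have [[p' q'] /= [q'0 ->]] := gx v.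
  rewrite !fE // -!mulNr !addf_div ?alg_independent_eq0 //.
  by rewrite -!rmorphN -!rmorphM -!rmorphD fE // mulf_neq0.
have fM : monoid_morphism f.
  split=> [|u v]; first by have := fE1 1; rewrite !rmorph1.
  have [[p q] /= [q0 ->]] := gx u; have [[p' q'] /= [q'0 ->]] := gx v.
  by rewrite !fE // !mulf_div -!rmorphM fE // mulf_neq0.
pose fz := GRing.isZmodMorphism.Build _ _ f fB.
pose fm := GRing.isMonoidMorphism.Build _ _ f fM.
pose phi : {rmorphism ratfield n -> ratfield n} := HB.pack f fz fm.
have XE (w : {ffun 'I_n -> ratfield n}) i : w i = eval_at w 'X_i.
  by rewrite /= mmapX mmap1U.
exists phi => i.
by rewrite XE [RHS]XE; apply: fE1.
Qed.

(** Lets the two monomials of an exchange relation be recovered up to order. *)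
Lemma add_mpolyX_eq (m1 m2 m3 m4 : 'X_{1..n}) :
  'X_[m1] + 'X_[m2] = 'X_[m3] + 'X_[m4] :> {mpoly rat[n]} ->
  (m1 = m3 /\ m2 = m4) \/ (m1 = m4 /\ m2 = m3).
Proof.
have addI a b c : 'X_[a] + 'X_[b] = 'X_[a] + 'X_[c] :> {mpoly rat[n]} -> b = c.
  move=> /addrI /(congr1 (mcoeff b)); rewrite !mcoeffX eqxx.
  by case: eqP => // _ /eqP; rewrite oner_eq0.
move=> eqX; have [e13|n13] := eqVneq m1 m3.
  by left; split=> //; apply: (addI m1); rewrite eqX e13.
have [e14|n14] := eqVneq m1 m4.
  by right; split=> //; apply: (addI m1); rewrite eqX e14 addrC.
have /(congr1 (mcoeff m1)) := eqX.
rewrite !mcoeffD !mcoeffX eqxx ![_ == m1]eq_sym (negPf n13) (negPf n14) addr0.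
(* The coefficient at [m1] is 1 or 2 on the left and 0 on the right. *)
by case: eqP => _ /eqP; rewrite -?natrD pnatr_eq0.
Qed.

End Evaluation.

(** * Action of ring morphisms on seeds *)

Lemma tree_edge_sym n k (t u : tree n) : tree_edge k t u = tree_edge k u t.
Proof. exact: orbC. Qed.

(** Edges are reversible, so [P t] passes down to the empty word and from there up to any [u]. *)
Lemma tree_edge_ind n (t : tree n) (P : tree n -> Prop) :
  P t -> (forall k u v, tree_edge k u v -> P u -> P v) -> forall u, P u.
Proof.
move=> Pt edgeP.
have step k u v : tree_edge k u v -> (P u <-> P v).
  by move=> uv; split; apply: edgeP; [|rewrite tree_edge_sym]; exact: uv.
pose root : tree n := Sub [::] isT.
suff rootP u : P root <-> P u by move=> u; apply/rootP/(rootP t).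
case: u => w wP; elim: w wP => [|k w IHw] wP.
  by rewrite (_ : exist _ _ _ = root) //; apply: val_inj.
apply: iff_trans (IHw (path_sorted wP)) _.
by apply: (step k); rewrite /tree_edge /= eqxx.
Qed.

Section ClusterPattern.
Variables (n : nat) (S : cluster_pattern n).
Notation A := (cluster_algebra S).
Notation F := (ratfield n).
Implicit Types (t u v : tree n) (s : 'S_n) (e : {ffun 'I_n -> bool}).

Definition cluster_var t i : A := ClusterAlgebra (cluster_mem S t i).

Lemma cluster_neq0 t i : cluster (S t) i != 0.
Proof. by have [xP _ _] := seed_atP S t; apply: alg_independent_neq0. Qed.

(** The binomial equal to $x_k x'_k$ in the exchange relation; [x] is a bare function so that it may
    also be the image of a cluster under a morphism. *)
Definition exchange_sum (x : 'I_n -> F) (B : 'M[int]_n) k : F :=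
  \prod_j x j ^ posp (B j k) + \prod_j x j ^ posp (- B j k).

(** Column [k] changes by the single sign [e k], which at most swaps the two monomials. *)
Lemma exchange_sum_perm s e B B' (x : 'I_n -> F) k :
  signed_perm s e B B' ->
  exchange_sum x B' (s k) = exchange_sum (x \o s) B k.
Proof.
move=> [BB' _]; rewrite /exchange_sum.
rewrite (reindex_inj (@perm_inj _ s)) [X in _ + X](reindex_inj (@perm_inj _ s)).
case ek: (e k); [rewrite addrC|]; congr (_ + _); apply: eq_bigr => j _.
all: by rewrite BB' ek ?mulN1r ?mul1r ?opprK.
Qed.

Lemma cluster_edge k t u : tree_edge k t u ->
  cluster (S u) = [ffun i => if i == k
    then (cluster (S t) k)^-1 * exchange_sum (cluster (S t)) (exchange (S t)) k
    else cluster (S t) i].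
Proof. by move=> /(seed_at_mutate S) ->; apply/ffunP => i; rewrite !ffunE. Qed.

Lemma exprz_posp (R : unitRingType) (x : R) b : x ^ posp b = x ^+ `|posp b|%N.
Proof. by rewrite -[in LHS](gez0_abs (posp_ge0 b)). Qed.

(** Multiplied out, the exchange relation is a polynomial identity inside [A], so ring morphisms
    preserve it. *)
Lemma rmorph_cluster_var_mutated (g : {rmorphism A -> F}) k t u :
  tree_edge k t u ->
  g (cluster_var u k) * g (cluster_var t k) =
  exchange_sum (fun j => g (cluster_var t j)) (exchange (S t)) k.
Proof.
(* Natural exponents make the monomials elements of [A], where [g] is defined. *)
move=> tu; pose P c := \prod_j cluster_var t j ^+ `|posp (c * exchange (S t) j k)|%N.
have PE c (h : {rmorphism A -> F}) : h (P c)
    = \prod_j h (cluster_var t j) ^ posp (c * exchange (S t) j k).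
  by rewrite rmorph_prod; apply: eq_bigr => j _; rewrite rmorphXn exprz_posp.
have PE2 (h : {rmorphism A -> F}) :
    exchange_sum (fun j => h (cluster_var t j)) (exchange (S t)) k = h (P 1 + P (-1)).
  rewrite rmorphD !PE /exchange_sum.
  by congr (_ + _); apply: eq_bigr => j _; rewrite ?mul1r ?mulN1r.
rewrite PE2 -rmorphM; congr (g _); apply: val_inj.
rewrite rmorphM -PE2 /= (cluster_edge tu) ffunE eqxx.
by rewrite mulrAC mulVf ?cluster_neq0 // mul1r.
Qed.

(** Values in the field cover both morphisms [A -> A] followed by the inclusion and restrictions of
    field morphisms. *)
Definition maps_cluster (g : A -> F) s t t' :=
  forall i, g (cluster_var t i) = cluster (S t') (s i).

Lemma signed_perm_edge s e k t t' u u' :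
  tree_edge k t u -> tree_edge (s k) t' u' ->
  signed_perm s e (exchange (S t)) (exchange (S t')) ->
  signed_perm s e (exchange (S u)) (exchange (S u')).
Proof.
move=> /(seed_at_mutate S) -> /(seed_at_mutate S) ->.
exact: signed_perm_mutate.
Qed.

(** The image of the mutated variable satisfies the exchange relation at [t'], which determines it
    because cluster variables are nonzero. *)
Lemma maps_cluster_edge (g : {rmorphism A -> F}) s e k t t' u u' :
  tree_edge k t u -> tree_edge (s k) t' u' ->
  signed_perm s e (exchange (S t)) (exchange (S t')) ->
  maps_cluster g s t t' -> maps_cluster g s u u'.
Proof.
move=> tu tu' BB' gP i; rewrite (cluster_edge tu') ffunE (inj_eq perm_inj).
case: eqP => [->|/eqP ik]; last first.
  rewrite -gP; congr (g _); apply: val_inj => /=.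
  by rewrite (cluster_edge tu) ffunE (negPf ik).
rewrite (exchange_sum_perm _ _ BB'); apply: (mulIf (cluster_neq0 t' (s k))).
rewrite mulrAC mulVf ?cluster_neq0 // mul1r -gP (rmorph_cluster_var_mutated _ tu).
by congr exchange_sum; apply/funext => j; rewrite gP.
Qed.

Lemma maps_cluster_everywhere (g : {rmorphism A -> F}) s e t t' :
  signed_perm s e (exchange (S t)) (exchange (S t')) -> maps_cluster g s t t' ->
  forall u, exists u', signed_perm s e (exchange (S u)) (exchange (S u')) /\
    maps_cluster g s u u'.
Proof.
move=> BB' gP; elim/(@tree_edge_ind _ t); first by exists t'.
move=> k u v uv [u' [BBu gu]]; have [v' uv'] := tree_neighbor (s k) u'.
exists v'; split; first exact: signed_perm_edge uv uv' BBu.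
exact: maps_cluster_edge uv uv' BBu gu.
Qed.

Lemma cluster_algebra_ind (U : set F) :
  GRing.subring_closed (mem U) -> (forall t i, U (cluster (S t) i)) ->
  forall a : A, U (val a).
Proof.
move=> subU varU a; have /set_mem := valP a.
by apply; split=> // _ [t [i ->]].
Qed.

(** Agreement spreads along edges to all cluster variables, and these generate [A]. *)
Lemma maps_cluster_unique (f g : {rmorphism A -> F}) s e t t' :
  signed_perm s e (exchange (S t)) (exchange (S t')) ->
  maps_cluster f s t t' -> maps_cluster g s t t' -> f =1 g.
Proof.
move=> BB' fP gP a.
have fgx : forall u i, f (cluster_var u i) = g (cluster_var u i).
  suff H u : exists u', [/\ signed_perm s e (exchange (S u)) (exchange (S u')),
      maps_cluster f s u u' & maps_cluster g s u u'].
    by move=> u i; have [u' [_ -> ->]] := H u.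
  elim/(@tree_edge_ind _ t): u; first by exists t'.
  move=> k u v uv [u' [BBu fu gu]]; have [v' uv'] := tree_neighbor (s k) u'.
  exists v'; split; first exact: signed_perm_edge uv uv' BBu.
    exact: maps_cluster_edge uv uv' BBu fu.
  exact: maps_cluster_edge uv uv' BBu gu.
(* The elements on which [f] and [g] agree form a subring, taken inside the field so that
   [cluster_algebra_ind] applies. *)
have [b /val_inj-> //] : [set z | exists2 b : A, z = val b & f b = g b] (val a).
apply: cluster_algebra_ind => [|t1 i]; last by exists (cluster_var t1 i).
split=> [|x y /set_mem[b -> fb] /set_mem[c -> fc]|x y /set_mem[b -> fb] /set_mem[c -> fc]].
- by apply/mem_set; exists 1; rewrite ?rmorph1.
- by apply/mem_set; exists (b - c); rewrite ?rmorphB ?fb ?fc.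
- by apply/mem_set; exists (b * c); rewrite ?rmorphM ?fb ?fc.
Qed.

End ClusterPattern.

(** * Cluster automorphisms *)

(** Here $d_i b_{ij}=-d_j b_{ji}$ with $d_i,d_j>0$. This later ties the signs of columns $i$ and $j$
    together. *)
Lemma skew_symmetrizable_sign n (B : 'M[int]_n) i j :
  skew_symmetrizable B -> B i j != 0 -> B i j * B j i < 0.
Proof.
move=> [d d_gt0]; rewrite mul_diag_mx => /matrixP /(_ j i); rewrite !mxE => dB Bij.
rewrite -(pmulr_rlt0 _ (d_gt0 j)) mulrCA -[_ * B j i]opprK -dB mulrN oppr_lt0.
by rewrite mulrCA pmulr_rgt0 // -expr2 exprn_even_gt0.
Qed.

Section Automorphisms.
Variables (n : nat) (S : cluster_pattern n).
Notation A := (cluster_algebra S).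
Notation F := (ratfield n).
Notation Aut := (@cluster_automorphisms n S).
Implicit Types (t u v : tree n) (s : 'S_n) (e : {ffun 'I_n -> bool}).
Implicit Types (f g : A -> A).

Definition exchange_exponents (B : 'M[int]_n) k : 'X_{1..n} :=
  [multinom `|posp (B j k)|%N | j < n].

Lemma exchange_sum_eval (x : {ffun 'I_n -> F}) (B : 'M[int]_n) k :
  exchange_sum x B k = eval_at x
    ('X_[exchange_exponents B k] + 'X_[exchange_exponents (- B) k]).
Proof.
rewrite rmorphD !eval_atX /exchange_sum.
by congr (_ + _); apply: eq_bigr => j _; rewrite exprz_posp mnmE ?mxE.
Qed.

(** By independence the polynomials agree, hence so do their monomials up to order; [b] records a
    swap, and the positive and negative parts give back the column. *)
Lemma exchange_sum_inj (x : {ffun 'I_n -> F}) (B C : 'M[int]_n) k :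
  alg_independent x -> exchange_sum x B k = exchange_sum x C k ->
  exists b : bool, forall j, C j k = (-1) ^+ b * B j k.
Proof.
move=> xP; rewrite !exchange_sum_eval => /(alg_independent_inj xP).
have posE M1 M2 j : exchange_exponents M1 k = exchange_exponents M2 k ->
    posp (M1 j k) = posp (M2 j k).
  move=> /mnmP /(_ j); rewrite !mnmE => /(congr1 Posz).
  by rewrite !gez0_abs ?posp_ge0.
case/add_mpolyX_eq => -[/posE eq1 /posE eq2]; [exists false|exists true] => j.
  have := eq2 j; rewrite !mxE mul1r => eqN.
  by rewrite -(pospB (C j k)) -(pospB (B j k)) eq1 eqN.
have := eq1 j; have := eq2 j; rewrite !mxE mulN1r => eqN eqP.
by rewrite -(pospB (C j k)) -(pospB (B j k)) eqP eqN opprB.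
Qed.

(** Each column is determined up to its own sign. If $b_{ij}\ne 0$, then $b_{ij}b_{ji}$ and its
    counterpart in $B'$ are both negative and differ by $(-1)^{e_i+e_j}$, so $e_i=e_j$. *)
Lemma signed_perm_of_exchange_sum t t' s :
  (forall k, exchange_sum (cluster (S t') \o s) (exchange (S t)) k
    = exchange_sum (cluster (S t')) (exchange (S t')) (s k)) ->
  exists e, signed_perm s e (exchange (S t)) (exchange (S t')).
Proof.
move=> eqX; have [xP _ B'P] := seed_atP S t'; have [_ _ BP] := seed_atP S t.
set B := exchange (S t) in eqX BP *; set B' := exchange (S t') in eqX B'P *.
pose y : {ffun 'I_n -> F} := [ffun i => cluster (S t') (s i)].
have yE : cluster (S t') \o s = y by apply/funext => i; rewrite ffunE.
pose C : 'M[int]_n := \matrix_(i, j) B' (s i) (s j).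
have CB' : signed_perm s (const_sign n false) C B'.
  by split=> i j; rewrite !ffunE // mxE mul1r.
have /fin_all_exists [e eP] k : exists b : bool,
    forall j, B' (s j) (s k) = (-1) ^+ b * B j k.
  have := eqX k; rewrite (exchange_sum_perm _ _ CB') yE.
  move=> /(exchange_sum_inj (alg_independent_perm xP)) [b bP].
  by exists b => j; rewrite -bP mxE.
exists [ffun k => e k]; split=> i j; rewrite !ffunE // => Bij.
have Bij_lt0 := skew_symmetrizable_sign BP Bij.
have /(skew_symmetrizable_sign B'P) : B' (s i) (s j) != 0.
  by rewrite eP mulf_neq0 ?signr_eq0.
rewrite !eP mulrACA -signr_addb; move: Bij_lt0.
case: (e i); case: (e j) => //= Bij_lt0.
  by rewrite mulN1r oppr_lt0 ltNge ltW.
by rewrite mulN1r oppr_lt0 ltNge ltW.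
Qed.

(** Trades the condition on neighboring clusters in the definition of a cluster automorphism for one
    on exchange matrices. *)
Definition seed_iso f s e t t' :=
  (forall i, f (cluster_var S t i) = cluster_var S t' (s i)) /\
  signed_perm s e (exchange (S t)) (exchange (S t')).

Lemma apply_cluster_at f t i :
  apply_cluster f (cluster (S t)) i = val (f (cluster_var S t i)).
Proof.
rewrite ffunE; congr (val (f _)); apply: val_inj.
by rewrite val_insubd cluster_mem.
Qed.

(** Forward, applying [f] to the exchange relations equates exchange sums, which fix the columns up
    to sign; backward, matching matrices carry mutated clusters to mutated clusters. *)
Lemma cluster_automorphismP f :
  Aut f <-> [/\ exists g : {rmorphism A -> A}, f = g, bijective f &
    exists t t' s e, seed_iso f s e t t'].
Proof.
split=> [[fB fM fbij [t [t' [s [fx fmu]]]]]|[[g ->] gbij [t [t' [s [e [gx BB']]]]]]].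
  pose fz := GRing.isZmodMorphism.Build _ _ f fB.
  pose fm := GRing.isMonoidMorphism.Build _ _ f fM.
  pose g : {rmorphism A -> A} := HB.pack f fz fm.
  split=> //; first by exists g.
  have gx i : val (g (cluster_var S t i)) = cluster (S t') (s i).
    by rewrite -fx ffunE permK apply_cluster_at.
  have [e BB'] : exists e, signed_perm s e (exchange (S t)) (exchange (S t')).
    apply: signed_perm_of_exchange_sum => k.
    have [u tu] := tree_neighbor k t; have [u' tu'] := tree_neighbor (s k) t'.
    have := rmorph_cluster_var_mutated (val \o g) tu.
    have := congr1 (fun x : {ffun _} => x (s k)) (fmu k).
    have -> : mutate_cluster k (S t) = cluster (S u) by rewrite (seed_at_mutate S tu).
    have -> : mutate_cluster (s k) (S t') = cluster (S u').
      by rewrite (seed_at_mutate S tu').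
    rewrite ffunE permK apply_cluster_at (cluster_edge S tu') ffunE eqxx /= => ->.
    rewrite gx mulrAC mulVf ?cluster_neq0 // mul1r => ->.
    by congr exchange_sum; apply/funext => j /=; rewrite gx.
  by exists t, t', s, e; split=> // i; apply: val_inj; apply: gx.
split=> //; [exact: rmorphB|by split; [exact: rmorph1|exact: rmorphM]|].
have gmaps : maps_cluster (val \o g) s t t' by move=> i /=; rewrite gx.
exists t, t', s; split=> [|k].
  by apply/ffunP=> i; rewrite ffunE apply_cluster_at gx /= permKV.
have [u tu] := tree_neighbor k t; have [u' tu'] := tree_neighbor (s k) t'.
have -> : mutate_cluster k (S t) = cluster (S u) by rewrite (seed_at_mutate S tu).
have -> : mutate_cluster (s k) (S t') = cluster (S u').
  by rewrite (seed_at_mutate S tu').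
apply/ffunP=> i; rewrite ffunE apply_cluster_at.
by rewrite -[in RHS](permKV s i); apply: (maps_cluster_edge tu tu' BB' gmaps).
Qed.

Lemma seed_iso_edge f s e k t t' u u' : Aut f ->
  tree_edge k t u -> tree_edge (s k) t' u' ->
  seed_iso f s e t t' -> seed_iso f s e u u'.
Proof.
move=> /cluster_automorphismP[[g ->] _ _] tu tu' [gx BB'].
split; last exact: signed_perm_edge tu tu' BB'.
have gmaps : maps_cluster (val \o g) s t t' by move=> i /=; rewrite gx.
by move=> i; apply: val_inj; apply: (maps_cluster_edge tu tu' BB' gmaps).
Qed.

Lemma seed_iso_everywhere f s e t t' : Aut f -> seed_iso f s e t t' ->
  forall u, exists u', seed_iso f s e u u'.
Proof.
move=> fA tt'; elim/(@tree_edge_ind _ t); first by exists t'.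
move=> k u v uv [u' uu']; have [v' uv'] := tree_neighbor (s k) u'.
by exists v'; apply: seed_iso_edge uv uv' uu'.
Qed.

(** Between two given vertices an automorphism depends only on [s], which leaves finitely many. *)
Lemma seed_iso_unique f g s e e' t t' : Aut f -> Aut g ->
  seed_iso f s e t t' -> seed_iso g s e' t t' -> f = g.
Proof.
move=> /cluster_automorphismP[[f1 ->] _ _] /cluster_automorphismP[[g1 ->] _ _].
move=> [fx BB'] [gx _]; apply/funext => a; apply: val_inj.
apply: (@maps_cluster_unique _ _ (val \o f1) (val \o g1) _ _ _ _ BB') => i /=.
  by rewrite fx.
by rewrite gx.
Qed.

Lemma seed_iso_id t : seed_iso id 1%g (const_sign n false) t t.
Proof. by split=> [i|]; [rewrite perm1|exact: signed_perm_id]. Qed.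

Lemma seed_iso_comp f g s1 e1 s2 e2 t u v :
  seed_iso f s1 e1 t u -> seed_iso g s2 e2 u v ->
  seed_iso (g \o f) (s1 * s2)%g [ffun i => e1 i (+) e2 (s1 i)] t v.
Proof.
move=> [fx B1] [gx B2]; split=> [i|]; last exact: signed_perm_comp B1 B2.
by rewrite /= fx gx permM.
Qed.

Lemma seed_iso_inv f g s e t u : cancel f g ->
  seed_iso f s e t u ->
  seed_iso g (s^-1)%g [ffun i => e ((s^-1)%g i)] u t.
Proof.
move=> fK [fx B1]; split=> [i|]; last exact: signed_perm_inv.
by rewrite -{1}(permKV s i) -fx fK.
Qed.

Lemma cluster_automorphisms_comp f g : Aut f -> Aut g -> Aut (f \o g).
Proof.
move=> fA gA.
have [[f1 fE] fbij [u [u' [s2 [e2 uP]]]]] := (cluster_automorphismP f).1 fA.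
have [[g1 gE] gbij [t [t' [s1 [e1 tP]]]]] := (cluster_automorphismP g).1 gA.
have [t'' tP'] := seed_iso_everywhere fA uP t'.
apply/cluster_automorphismP; split; last by do 4!eexists; apply: seed_iso_comp tP tP'.
  by exists (f1 \o g1); rewrite fE gE.
exact: bij_comp.
Qed.

Lemma cluster_automorphisms_inv f g : Aut f -> cancel f g -> cancel g f -> Aut g.
Proof.
move=> /cluster_automorphismP[[f1 ->] _ [t [t' [s [e tP]]]]] fK gK.
have gB : zmod_morphism g by apply: can2_zmod_morphism fK gK.
have gM : monoid_morphism g by apply: can2_monoid_morphism fK gK.
pose gz := GRing.isZmodMorphism.Build _ _ g gB.
pose gm := GRing.isMonoidMorphism.Build _ _ g gM.
pose g1 : {rmorphism A -> A} := HB.pack g gz gm.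
apply/cluster_automorphismP; split; [by exists g1|by exists f1|].
by do 4!eexists; apply: seed_iso_inv fK tP.
Qed.

Lemma cluster_automorphisms_subgroup (t0 : tree n) : composition_subgroup Aut.
Proof.
split; [|exact: cluster_automorphisms_comp|exact: cluster_automorphisms_inv].
apply/cluster_automorphismP; split; [by exists idfun|by exists id|].
by do 4!eexists; apply: (seed_iso_id t0).
Qed.

(** The field morphism matching the two clusters sends every cluster to a cluster, so it restricts
    to [A]; the inverse relation yields its inverse. *)
Lemma cluster_automorphism_exists s e t t' :
  signed_perm s e (exchange (S t)) (exchange (S t')) ->
  exists2 f, Aut f & seed_iso f s e t t'.
Proof.
have ex (s' : 'S_n) e' u u' : signed_perm s' e' (exchange (S u)) (exchange (S u')) ->
    exists f : {rmorphism A -> A}, seed_iso f s' e' u u'.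
  move=> BB'; have [xP gx _] := seed_atP S u; have [yP _ _] := seed_atP S u'.
  have [phi phiE] := field_morphism_of_clusters xP gx (alg_independent_perm (s := s') yP).
  have phix : maps_cluster (phi \o val : {rmorphism A -> F}) s' u u'.
    by move=> i; rewrite /= phiE ffunE.
  have phiA (a : A) : phi (val a) \in cluster_algebra_pred S.
    apply: (@cluster_algebra_ind _ S [set z | phi z \in cluster_algebra_pred S]).
      split=> [|y z /set_mem/= yA /set_mem/= zA|y z /set_mem/= yA /set_mem/= zA].
      - by apply/mem_set; rewrite /= rmorph1 rpred1.
      - by apply/mem_set; rewrite /= rmorphB rpredB.
      - by apply/mem_set; rewrite /= rmorphM rpredM.
    move=> v i; have [v' [_ vv']] := maps_cluster_everywhere BB' phix v.
    by have /= := vv' i; rewrite /mkset => ->; apply: cluster_mem.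
  pose f a : A := ClusterAlgebra (phiA a).
  have fB : zmod_morphism f by move=> a b; apply: val_inj; rewrite /= !rmorphB.
  have fM : monoid_morphism f.
    by split=> [|a b]; apply: val_inj; rewrite /= ?rmorph1 ?rmorphM.
  pose fz := GRing.isZmodMorphism.Build _ _ f fB.
  pose fm := GRing.isMonoidMorphism.Build _ _ f fM.
  pose f1 : {rmorphism A -> A} := HB.pack f fz fm.
  by exists f1; split=> // i; apply: val_inj; exact: phix.
(* The composite fixes the cluster at [u], hence is the identity by [maps_cluster_unique]. *)
have canc (s' : 'S_n) u u' (f g : {rmorphism A -> A}) :
    (forall i, f (cluster_var S u i) = cluster_var S u' (s' i)) ->
    (forall i, g (cluster_var S u' (s' i)) = cluster_var S u i) -> cancel f g.
  move=> fP gP a; apply: val_inj.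
  apply: (@maps_cluster_unique _ _ (val \o (g \o f)) val _ _ _ _
           (signed_perm_id (exchange (S u)))) => i; rewrite perm1 //=.
  by rewrite fP gP.
move=> BB'; have [f fP] := ex _ _ _ _ BB'.
have [g [gx _]] := ex _ _ _ _ (signed_perm_inv BB').
exists f => //; apply/cluster_automorphismP; split; [by exists f| |by exists t, t', s, e].
case: fP => fx _; exists g; first by apply: (canc s) fx _ => i; rewrite gx permK.
by apply: (canc s^-1%g) gx _ => i; rewrite fx permKV.
Qed.

End Automorphisms.

(** * Generators *)

(** If one edge added [k] and the other removed it, some word would begin with [k] twice. *)
Lemma tree_edge_unique n k (t u v : tree n) :
  tree_edge k t u -> tree_edge k t v -> u = v.
Proof.
have no_repeat (x y z : tree n) : val x = k :: val y -> val y = k :: val z -> False.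
  by move=> xE yE; have := valP x; rewrite xE yE /= eqxx.
case/orP=> /eqP uE /orP[] /eqP vE; apply: val_inj.
- by rewrite uE.
- by have := no_repeat _ _ _ uE vE.
- by have := no_repeat _ _ _ vE uE.
- by move: uE; rewrite vE => -[].
Qed.

Lemma tree_connected n (t u : tree n) :
  exists2 p, path (@tree_adj n) t p & last t p = u.
Proof.
elim/(@tree_edge_ind _ t): u => [|k u v uv [p pP pl]]; first by exists [::].
exists (rcons p v); last by rewrite last_rcons.
by rewrite rcons_path pP pl; apply/existsP; exists k.
Qed.

Lemma smallest_subgroup T (X : set (T -> T)) :
  composition_subgroup (smallest (@composition_subgroup T) X).
Proof.
split=> [H [[]//]|f g fX gX H HX|f g fX fK gK H HX]; have [[_ HM HV] _] := HX.
  by apply: HM; [apply: fX|apply: gX].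
by apply: (HV f) fK gK; apply: fX.
Qed.

Section FinitelyGenerated.
Variables (n : nat) (S : cluster_pattern n) (t0 : tree n).
Notation A := (cluster_algebra S).
Notation Aut := (@cluster_automorphisms n S).
Implicit Types (t u v : tree n) (s : 'S_n) (e : {ffun 'I_n -> bool}).
Implicit Types (f g h : A -> A).

Definition class_at t := matrix_class (exchange (S t)).

Definition class_iso f t t' := exists s b, seed_iso f s (const_sign n b) t t'.

Lemma class_iso_class_at f t t' : class_iso f t t' -> class_at t = class_at t'.
Proof. by move=> [s [b [_ BB']]]; apply/matrix_class_eq; exists s, b. Qed.

Lemma class_iso_exists t t' : class_at t = class_at t' ->
  exists2 f, Aut f & class_iso f t t'.
Proof.
move=> /matrix_class_eq[s [b /cluster_automorphism_exists[f fA fP]]].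
by exists f => //; exists s, b.
Qed.

Lemma class_iso_comp f g t u v :
  class_iso f t u -> class_iso g u v -> class_iso (g \o f) t v.
Proof.
move=> [s1 [b1 P1]] [s2 [b2 P2]]; exists (s1 * s2)%g, (b1 (+) b2).
have := seed_iso_comp P1 P2; congr (seed_iso _ _ _ _ _).
by apply/ffunP=> i; rewrite !ffunE.
Qed.

Lemma class_iso_inv f g t u : cancel f g -> class_iso f t u -> class_iso g u t.
Proof.
move=> fK [s [b P]]; exists (s^-1)%g, b.
have := seed_iso_inv fK P; congr (seed_iso _ _ _ _ _).
by apply/ffunP=> i; rewrite !ffunE.
Qed.

Lemma cluster_automorphism_inverse f : Aut f ->
  exists g, [/\ Aut g, cancel f g & cancel g f].
Proof.
move=> fA; have [_ [g fK gK] _] := (cluster_automorphismP f).1 fA.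
by exists g; split=> //; apply: cluster_automorphisms_inv fK gK.
Qed.

Lemma seed_iso_path f s e t t' p : Aut f -> seed_iso f s e t t' ->
  path (@tree_adj n) t p -> exists p', [/\ path (@tree_adj n) t' p',
    size p' = size p & seed_iso f s e (last t p) (last t' p')].
Proof.
move=> fA; elim: p t t' => [|u p IHp] t t' tt' /=; first by exists [::].
move=> /andP[/existsP[k tu] pP]; have [u' tu'] := tree_neighbor (s k) t'.
have [p' [p'P sp' lp']] := IHp _ _ (seed_iso_edge fA tu tu' tt') pP.
exists (u' :: p'); split=> //=; last by rewrite sp'.
by rewrite p'P andbT; apply/existsP; exists (s k).
Qed.

(* The class of t0 must be represented by t0 itself, so that the rewriting along
   a path starts from an automorphism fixing t0. *)
Definition class_rep (c : set 'M[int]_n) : tree n :=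
  if `[< c = class_at t0 >] then t0 else xget t0 [set t | class_at t = c].

Lemma class_rep_root : class_rep (class_at t0) = t0.
Proof. by rewrite /class_rep asboolT. Qed.

Lemma class_repK t : class_at (class_rep (class_at t)) = class_at t.
Proof.
rewrite /class_rep; case: asboolP => [->//|_].
by apply: (@xgetPex _ t0 [set u | class_at u = class_at t]); exists t.
Qed.

(** The class of [t0] is added because [return_classes] is empty when no path returns. *)
Definition path_classes : set (set 'M[int]_n) :=
  [set class_at t0] `|` return_classes S t0.

(** Schreier generators; the alternative [v = class_rep c] supplies the automorphisms stabilizing
    [t0]. *)
Definition step_gens : set (A -> A) :=
  [set f | Aut f /\ exists c c' v, [/\ path_classes c, path_classes c',
    v = class_rep c \/ (exists k, tree_edge k (class_rep c) v) &
    class_iso f (class_rep c') v]].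

(* Two automorphisms with the same permutation and block signs differ by one
   that sends t0 to a vertex with the same exchange matrix. *)
Definition coset_gen (se : 'S_n * {ffun 'I_n -> bool}) : A -> A :=
  @xget {classic (A -> A)} id [set f | Aut f /\ exists t, seed_iso f se.1 se.2 t0 t].

Definition gens : set (A -> A) := step_gens `|` range coset_gen.

Notation H := (smallest (@composition_subgroup A) gens).

Lemma coset_gen_aut se : Aut (coset_gen se).
Proof.
(* The default value [id] is itself an automorphism. *)
rewrite /coset_gen; case: xgetP => [f _ []//|_].
by have [] := cluster_automorphisms_subgroup S t0.
Qed.

(** By [seed_iso_unique] a step generator is determined by two classes, a permutation, a global sign
    and an optional edge label. *)
Lemma finite_gens : finite_set (return_classes S t0) -> finite_set gens.
Proof.
move=> finC; rewrite /gens finite_setU; split; last first.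
  exact/finite_image/finite_finset.
have finP : finite_set path_classes by rewrite /path_classes finite_setU; split.
pose target c (k : option 'I_n) :=
  if k is Some k then sval (cid (tree_neighbor k (class_rep c))) else class_rep c.
pose gen (i : (set 'M[int]_n * set 'M[int]_n) * ('S_n * bool * option 'I_n)) : A -> A :=
  @xget {classic (A -> A)} id [set f | Aut f /\
    seed_iso f i.2.1.1 (const_sign n i.2.1.2) (class_rep i.1.2) (target i.1.1 i.2.2)].
have finI : finite_set (gen @` ((path_classes `*` path_classes) `*` setT)).
  by apply/finite_image/finite_setX; [exact: finite_setX|exact: finite_finset].
apply: sub_finite_set finI => f [fA [c [c' [v [cC c'C vP [s [b fP]]]]]]].
have [k vE] : exists k, v = target c k.
  case: vP => [->|[k vk]]; first by exists None.
  by exists (Some k) => /=; case: cid => w /= /(tree_edge_unique vk).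
exists ((c, c'), ((s, b), k)) => //; rewrite /gen.
case: xgetP => [g _ [gA /= gP]|/(_ f)]; last by case; split; rewrite -?vE.
by apply: seed_iso_unique gA fA gP _; rewrite -vE; exact: fP.
Qed.

(* Schreier rewriting along p. *)
Lemma step_in_subgroup p h : path (@tree_adj n) t0 p ->
  (forall v, v \in p -> path_classes (class_at v)) -> Aut h ->
  class_iso h (class_rep (class_at (last t0 p))) (last t0 p) -> H h.
Proof.
have [_ HM _] := smallest_subgroup gens.
have C0 : path_classes (class_at t0) by left.
elim/last_ind: p h => [|p v IHp] h /=.
  move=> _ _ hA hP; apply: sub_gen_smallest; left; split=> //.
  by exists (class_at t0), (class_at t0), t0; split=> //; left; rewrite class_rep_root.
rewrite rcons_path last_rcons => /andP[pP /existsP[k uv]] pC hA hP.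
set u := last t0 p in uv.
have Cv : path_classes (class_at v) by apply: pC; rewrite mem_rcons mem_head.
have pC' w : w \in p -> path_classes (class_at w).
  by move=> wp; apply: pC; rewrite mem_rcons inE wp orbT.
have Cu : path_classes (class_at u).
  by have := mem_last t0 p; rewrite inE => /orP[/eqP|/pC'//]; rewrite /u => ->.
(* [g] leads from the representative to [u], and the induction hypothesis covers it; its inverse
   [g'] moves the edge from [u] to [v] to an edge at the representative. *)
have [g gA gP] := class_iso_exists (class_repK u).
have [g' [g'A gK g'K]] := cluster_automorphism_inverse gA.
have [s [b g'P]] := class_iso_inv gK gP.
have [v' uv'] := tree_neighbor (s k) (class_rep (class_at u)).
have g'v : class_iso g' v v' by exists s, b; apply: seed_iso_edge uv uv' g'P.
(* [g' \o h] sends the representative for [v] to a neighbor of the one for [u], so it is a step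
   generator. *)
have -> : h = g \o (g' \o h) by apply/funext => a /=; rewrite g'K.
apply: HM; first exact: IHp pP pC' gA gP.
apply: sub_gen_smallest; left; split; first exact: cluster_automorphisms_comp.
exists (class_at u), (class_at v), v'; split=> //; first by right; exists (s k).
exact: class_iso_comp hP g'v.
Qed.

Lemma first_return p v : path (@tree_adj n) t0 (rcons p v) ->
  uniq (t0 :: rcons p v) -> class_at v = class_at t0 ->
  ~~ has (fun u => `[< class_at u = class_at t0 >]) p ->
  return_paths S 1 t0 (rcons p v).
Proof.
move=> pP pU vt0 pN; exists v; split=> //.
  by rewrite /tree_path pP last_rcons eqxx.
rewrite /weight /= -cats1 count_cat /= asboolT // asboolT //.
by move: pN; rewrite has_count -leqNgt leqn0 => /eqP ->.
Qed.

(** Induction on the length of a walk from [t0]. Its part up to the first return yields some [h] by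
    [step_in_subgroup]; the inverse of [h] moves the rest to a shorter walk from [t0]. *)
Lemma class_iso_in_subgroup f t : Aut f -> class_iso f t0 t -> H f.
Proof.
have [_ HM _] := smallest_subgroup gens.
have [p pP <-] := tree_connected t0 t.
have [m le_pm] := ubnP (size p); elim: m p f le_pm pP => // m IHm p f le_pm pP fA.
(* Walks in [return_paths] have no repeated vertices; removing repetitions does not lengthen the
   walk. *)
case/shortenP: pP => p' p'P p'U p'p fP.
have {le_pm p p'p} le_pm : (size p' <= m)%N.
  by rewrite -ltnS; apply: leq_trans le_pm; rewrite ltnS uniq_leq_size //; case/andP: p'U.
have lp' : class_at (last t0 p') = class_at t0 by rewrite (class_iso_class_at fP).
have [p'0|] := eqVneq p' [::].
  by apply: (step_in_subgroup (p := [::])) => //=; rewrite class_rep_root; rewrite p'0 in fP.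
move=> p'0; have : has (fun u => `[< class_at u = class_at t0 >]) p'.
  apply/hasP; exists (last t0 p'); last exact/asboolP.
  by case: (p') p'0 => //= x q _; apply: mem_last.
move=> p'h; case: (split_find p'h) p'P p'U le_pm fP => v p1 p2 /asboolP vt0 p1N.
rewrite cat_path last_rcons -cat_cons cat_uniq last_cat last_rcons size_cat size_rcons.
move=> /andP[p1P p2P] /andP[p1U _] le_pm fP.
have p1R := first_return p1P p1U vt0 p1N.
have [h hA hP] := class_iso_exists (esym vt0).
have Hh : H h.
  apply: (step_in_subgroup p1P) => //; last first.
    by rewrite last_rcons vt0 class_rep_root.
  by move=> u up; right; exists (rcons p1 v) => //; exists u; rewrite // inE up orbT.
have [h' [h'A hK h'K]] := cluster_automorphism_inverse hA.
have [s [b h'P]] := class_iso_inv hK hP.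
have [q [qP qs ql]] := seed_iso_path h'A h'P p2P.
have -> : f = h \o (h' \o f) by apply/funext => a /=; rewrite h'K.
apply: HM => //; apply: (IHm q) => //.
- by rewrite qs; apply: leq_trans le_pm; rewrite addSn ltnS leq_addl.
- exact: cluster_automorphisms_comp.
- by apply: class_iso_comp fP _; exists s, b.
Qed.

(** The coset generator [g] for the permutation and signs of [f] cancels both, so [g' \o f]
    preserves exchange matrices exactly and the previous case applies. *)
Lemma aut_in_subgroup f : Aut f -> H f.
Proof.
have [_ HM _] := smallest_subgroup gens.
move=> fA; have [_ _ [t [t' [s [e tP]]]]] := (cluster_automorphismP f).1 fA.
have [{}t' {t}tP] := seed_iso_everywhere fA tP t0.
have [gA [u gP]] : Aut (coset_gen (s, e)) /\ exists t, seed_iso (coset_gen (s, e)) s e t0 t.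
  by rewrite /coset_gen; case: xgetP => [g _ []//|/(_ f)[]]; split=> //; exists t'.
set g := coset_gen (s, e) in gA gP.
have [g' [g'A gK g'K]] := cluster_automorphism_inverse gA.
have [v g'P] := seed_iso_everywhere g'A (seed_iso_inv gK gP) t'.
have -> : f = g \o (g' \o f) by apply/funext => a /=; rewrite g'K.
apply: HM; first by apply: sub_gen_smallest; right; exists (s, e).
apply: (@class_iso_in_subgroup _ v); first exact: cluster_automorphisms_comp.
exists 1%g, false; have := seed_iso_comp tP g'P; rewrite mulgV.
congr (seed_iso _ _ _ _ _); apply/ffunP=> i.
by rewrite !ffunE permK addbb.
Qed.

End FinitelyGenerated.

Theorem lemma3p1 (n : nat) (n_gt0 : (0 < n)%N) (S : cluster_pattern n)
    (t0 : tree n) :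
  finite_set (return_classes S t0) ->
  finitely_generated_group (@cluster_automorphisms n S).
Proof.
move=> finC; exists (@gens n S t0); first exact: finite_gens.
apply/seteqP; split=> f; first exact: aut_in_subgroup.
apply: smallest_sub; first exact: cluster_automorphisms_subgroup t0.
by move=> g [[]//|[se _ <-]]; apply: coset_gen_aut.
Qed.
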